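(* There exists a constant $\varepsilon > 0$ such that $U(n) \leq (1-\varepsilon)\binom{n}{2}$ for all integers $n \geq 6$. Moreover, $$U(n) \leq \frac{2}{3}\binom{n}{2} + O(n\log n)$$ as $n \to \infty$.
   Context: Let $S_n$ be the symmetric group on $\{1,\dots,n\}$. For distinct $a,b \in \{1,\dots,n\}$ and $p\in[0,1]$, the lazy transposition $T=(a,b,p)$ is the random permutation that equals the transposition $(a,b)\in S_n$ with probability $p$ and the identity with probability $1-p$. $U(n)$ denotes the minimum length $\ell$ for which there exists a sequence of independent lazy transpositions $T_1,\dots,T_\ell$ (each with its own choice of $a,b,p$) such that the composition $T_1\cdots T_\ell$ is uniformly distributed over $S_n$. *)

(* Defs.v *)
From HB Require Import structures.
From mathcomp Require Import all_boot all_order all_algebra all_fingroup.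
From mathcomp Require Import all_classical all_reals all_analysis.

Set Implicit Arguments.
Unset Strict Implicit.
Unset Printing Implicit Defensive.

Import Order.TTheory GRing.Theory Num.Theory.
Import numFieldNormedType.Exports.

Local Open Scope ring_scope.

(* The points 1, ..., n are represented by 'I_n = {0, ..., n - 1}. *)
Record lazy_transposition (R : realType) (n : nat) := LazyTransposition {
  lt_fst : 'I_n;
  lt_snd : 'I_n;
  lt_prob : R;
  lt_neq : lt_fst != lt_snd;
  lt_prob01 : 0 <= lt_prob <= 1
}.

Definition lazy_law (R : realType) (n : nat) (T : lazy_transposition R n)
    (s : 'S_n) : R :=
  if s == tperm (lt_fst T) (lt_snd T) then lt_prob T
  else if s == 1%g then 1 - lt_prob T
  else 0.

(* By independence the joint law of (T_1, ..., T_l) on 'S_n ^ l is the product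
   of the individual laws; comp_law T is its image under composition. MathComp
   composes permutations from left to right; the opposite convention amounts to
   reversing the sequence T, which does not affect the lengths that can give
   the uniform law. *)
Definition comp_law (R : realType) (n l : nat)
    (T : 'I_l -> lazy_transposition R n) (s : 'S_n) : R :=
  \sum_(t : {ffun 'I_l -> 'S_n} | (\prod_(i < l) t i)%g == s)
    \prod_(i < l) lazy_law (T i) (t i).

Definition uniform_on_Sn (R : realType) (n : nat) (mu : 'S_n -> R) : Prop :=
  forall s : 'S_n, mu s = (#|[set: 'S_n]|%:R)^-1.

Definition achievable (R : realType) (n l : nat) : Prop :=
  exists T : 'I_l -> lazy_transposition R n, uniform_on_Sn (comp_law T).

Section Existence.
Variables (R : realType).

Definition ext_last (n l : nat) (T : 'I_l -> lazy_transposition R n)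
  (x : lazy_transposition R n) (i : 'I_l.+1) := oapp T x (unlift ord_max i).

Lemma comp_law0 (n : nat) (T : 'I_0 -> lazy_transposition R n) (s : 'S_n) :
  comp_law T s = (s == 1%g)%:R.
Proof.
rewrite /comp_law (eq_bigl (fun=> s == 1%g)); last first.
  by move=> t; rewrite big_ord0 eq_sym.
rewrite (eq_bigr (fun=> 1)); last by move=> t _; rewrite big_ord0.
case: eqP => _; last by rewrite big_pred0.
by rewrite sumr_const card_ffun card_ord expn0.
Qed.

Lemma sum_lazy_law (n : nat) (x : lazy_transposition R n) (g : 'S_n -> R) :
  \sum_s lazy_law x s * g s =
  lt_prob x * g (tperm (lt_fst x) (lt_snd x)) + (1 - lt_prob x) * g 1%g.
Proof.
have h : 1%g != tperm (lt_fst x) (lt_snd x).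
  apply/eqP => /permP /(_ (lt_fst x)); rewrite perm1 tpermL.
  by apply/eqP; exact: lt_neq.
rewrite (bigD1 (tperm (lt_fst x) (lt_snd x))) //= (bigD1 1%g) //=.
rewrite /lazy_law eqxx (negbTE h) eqxx big1 ?addr0 //.
by move=> s /andP[/negbTE -> /negbTE ->]; rewrite mul0r.
Qed.

Lemma comp_law_ext (n l : nat) (T : 'I_l -> lazy_transposition R n)
    (x : lazy_transposition R n) (s : 'S_n) :
  comp_law (ext_last T x) s =
  lt_prob x * comp_law T (s * tperm (lt_fst x) (lt_snd x))%g
  + (1 - lt_prob x) * comp_law T s.
Proof.
pose h (u : 'S_n * {ffun 'I_l -> 'S_n}) : {ffun 'I_l.+1 -> 'S_n} :=
  [ffun i => oapp u.2 u.1 (unlift ord_max i)].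
have hl u (i : 'I_l) : h u (widen_ord (leqnSn l) i) = u.2 i.
  rewrite ffunE; have -> : widen_ord (leqnSn l) i = lift ord_max i.
    by apply: val_inj; rewrite /= /bump leqNgt ltn_ord.
  by rewrite liftK.
have hm u : h u ord_max = u.1 by rewrite ffunE unlift_none.
have Tl (i : 'I_l) : ext_last T x (widen_ord (leqnSn l) i) = T i.
  rewrite /ext_last; have -> : widen_ord (leqnSn l) i = lift ord_max i.
    by apply: val_inj; rewrite /= /bump leqNgt ltn_ord.
  by rewrite liftK.
have Tm : ext_last T x ord_max = x by rewrite /ext_last unlift_none.
pose h' (f : {ffun 'I_l.+1 -> 'S_n}) : 'S_n * {ffun 'I_l -> 'S_n} :=
  (f ord_max, [ffun i => f (lift ord_max i)]).
rewrite /comp_law (reindex h) /=; last first.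
  exists h' => [[a f] _|f _].
    rewrite /h' hm; congr pair; apply/ffunP => i.
    by rewrite ffunE /h ffunE liftK.
  apply/ffunP => i; rewrite ffunE /h' /=.
  by case: unliftP => [j|] -> /=; rewrite ?ffunE.
transitivity (\sum_(y : 'S_n) lazy_law x y * comp_law T (s * y^-1)%g).
  rewrite /comp_law.
  under [RHS]eq_bigr do rewrite big_distrr /=.
  rewrite pair_big_dep /=; apply: eq_big => [[y f]|[y f] _] /=.
    rewrite big_ord_recr /= hm; under eq_bigr do rewrite hl.
    by rewrite -(canF_eq (mulgK y)) //= ; apply/eqP/eqP => [<-|->];
      rewrite ?mulgK ?mulgKV.
  rewrite big_ord_recr /= hm Tm mulrC; congr (_ * _).
  by apply: eq_bigr => i _; rewrite hl Tl.
by rewrite (sum_lazy_law x (fun y => comp_law T (s * y^-1)%g)) tpermV invg1 mulg1.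
Qed.

(* Law obtained from the uniform law on the permutations of {0, ..., k - 1}
   after swapping k with each of 0, ..., j - 1 with suitable probabilities. *)
Definition stage_law (n : nat) (k : 'I_n) (j : nat) (s : 'S_n) : R :=
  [forall i : 'I_n, (k < i)%N ==> (s i == i)]%:R / (k.+1)`!%:R
  * (if s k == k then (k.+1 - j)%:R else (s k < j)%:R).

Definition attained (n : nat) (mu : 'S_n -> R) : Prop :=
  exists l (T : 'I_l -> lazy_transposition R n), comp_law T =1 mu.

Lemma stage_law_step (n : nat) (k : 'I_n) (j : nat) :
  (j < k)%N -> attained (stage_law k j) -> attained (stage_law k j.+1).
Proof.
move=> jk [l [T TE]].
have jn : (j < n)%N by exact: ltn_trans jk (ltn_ord k).
pose a := Ordinal jn.
have ak : a != k by rewrite -val_eqE /= ltn_eqF.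
pose p : R := ((k.+1 - j)%:R)^-1.
have m1 : (1 <= k.+1 - j)%N by rewrite subn_gt0 ltnS ltnW.
have m1R : 1 <= (k.+1 - j)%:R :> R by rewrite ler1n.
have p01 : 0 <= p <= 1.
  by rewrite /p invr_ge0 ler0n invf_le1 // (lt_le_trans ltr01).
exists l.+1, (ext_last T (LazyTransposition ak p01)) => s.
rewrite comp_law_ext /= !TE /stage_law.
have -> : [forall i : 'I_n, (k < i)%N ==> ((s * tperm a k)%g i == i)] =
          [forall i : 'I_n, (k < i)%N ==> (s i == i)].
  apply: eq_forallb => i; case: (ltnP k i) => //= ki.
  rewrite permM -(inj_eq (@perm_inj _ (tperm a k))) tpermK.
  by rewrite tpermD // -val_eqE /= ltn_eqF // (ltn_trans jk).
rewrite permM mulrCA [X in _ + X]mulrCA -mulrDr; congr (_ * _).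
have mE : (k.+1 - j)%:R = (k.+1 - j.+1)%:R + 1 :> R.
  by rewrite natr1 subSS subSn // ltnW.
have m0 : (k.+1 - j)%:R != 0 :> R by rewrite gt_eqF // (lt_le_trans ltr01).
case: tpermP => [ska|skk|/eqP sa /eqP sk].
- rewrite eqxx ska (negbTE ak) /= ltnn ltnS leqnn mulr0 addr0.
  by rewrite /p mulVf.
- rewrite skk (negbTE ak) eqxx /= ltnn mulr0 add0r /p mulrBl mul1r mulVf //.
  by rewrite mE addrK.
- have sj : (s k == j :> nat) = false by exact: negbTE.
  by rewrite (negbTE sk) ltnS [in RHS]leq_eqVlt sj /= -mulrDl addrC subrK mul1r.
Qed.

Lemma stage_law_all (n : nat) (k : 'I_n) (j : nat) :
  (j <= k)%N -> attained (stage_law k 0) -> attained (stage_law k j).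
Proof.
by move=> + h; elim: j => // j IH jk; apply: stage_law_step => //; exact/IH/ltnW.
Qed.

Lemma stage_law_diag (n : nat) (k : nat) (kn : (k < n)%N) :
  attained (stage_law (Ordinal kn) k).
Proof.
elim: k kn => [|k IH] kn.
  have [T] : exists T : 'I_0 -> lazy_transposition R n, True.
    by unshelve eexists; [case|].
  exists 0%N, T => s; rewrite comp_law0 /stage_law /= factS fact0 divr1 subn0.
  have [->|s1] := eqVneq s 1%g.
    rewrite perm1 eqxx mulr1; congr (_%:R); apply/esym.
    by congr nat_of_bool; apply/forallP => i; rewrite perm1 eqxx implybT.
  case: (s (Ordinal kn) =P Ordinal kn) => [s0|_]; last by rewrite /= mulr0.
  rewrite mulr1; case: forallP => // h; case/eqP: s1; apply/permP => i.
  rewrite perm1; have [i0|i0] := posnP i.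
    by rewrite (_ : i = Ordinal kn) //; apply: val_inj.
  by have := h i; rewrite i0 => /eqP.
apply: stage_law_all => //.
have [l [T TE]] := IH (ltnW kn).
exists l, T => s; rewrite TE /stage_law /=.
set K := Ordinal (ltnW kn); set K' := Ordinal kn.
rewrite subn0.
have [sK'|sK'] := eqVneq (s K') K'; last first.
  rewrite mulr0; case: forallP => [h|_]; last by rewrite !mul0r.
  by have := h K'; rewrite /= ltnSn /= (negbTE sK').
have -> : [forall i : 'I_n, (k < i)%N ==> (s i == i)] =
          [forall i : 'I_n, (k.+1 < i)%N ==> (s i == i)].
  apply/forallP/forallP => h i; apply/implyP => ki.
    by have := h i; rewrite (ltnW ki).
  have := h i; rewrite ltn_neqAle ki andbT.
  have [e|//] := eqVneq k.+1 i.
  by move=> _; rewrite (_ : i = K') ?sK' //; apply: val_inj.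
case: forallP => [h|_]; last by rewrite !mul0r.
have -> : (if s K == K then (k.+1 - k)%:R else (s K < k)%:R) = 1 :> R.
  case: eqP => [_|/eqP sK]; first by rewrite subSn // subnn.
  suff -> : (s K < k)%N by [].
  rewrite ltnNge leq_eqVlt; apply/negP => /orP[/eqP e|sKk].
    by case/eqP: sK; apply: val_inj.
  have [e|e] := eqVneq (s K) K'.
    have /perm_inj : s K = s K' by rewrite sK'.
    by move/(congr1 val) => /= /eqP; rewrite ltn_eqF.
  have ks : (k.+1 < s K)%N.
    by rewrite ltn_neqAle sKk andbT eq_sym -[k.+1]/(val K') val_eqE.
  have := h (s K); rewrite ks /= => /eqP /perm_inj e2.
  by rewrite e2 /= ltnn in sKk.
rewrite mulr1 !div1r [(k.+2)`!]factS natrM invfM -mulrA mulrC -mulrA divff ?mulr1 ?pnatr_eq0 //.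
Qed.

Lemma achievable_exists (n : nat) : exists l, `[< achievable R n l >].
Proof.
suff [l [T TE]] : attained (fun _ : 'S_n => (#|[set: 'S_n]|%:R)^-1 : R).
  by exists l; apply/asboolP; exists T.
rewrite cardsT card_Sn.
case: n => [|n].
  have [T] : exists T : 'I_0 -> lazy_transposition R 0, True.
    by unshelve eexists; [case|].
  exists 0%N, T => s; rewrite comp_law0 fact0 invr1.
  by rewrite (_ : s = 1%g) ?eqxx //; apply/permP => -[].
have [l [T TE]] := stage_law_diag (ltnSn n).
exists l, T => s; rewrite TE /stage_law /=.
have -> : [forall i : 'I_n.+1, (n < i)%N ==> (s i == i)] = true.
  by apply/forallP => i; rewrite ltnNge -ltnS ltn_ord.
case: eqP => [_|/eqP sK]; first by rewrite subSn // subnn mulr1 div1r.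
suff -> : (s (Ordinal (ltnSn n)) < n)%N by rewrite mulr1 div1r.
by rewrite ltn_neqAle -ltnS ltn_ord andbT -val_eqE in sK *.
Qed.

End Existence.

Definition U (R : realType) (n : nat) : nat := ex_minn (achievable_exists R n).

Lemma UP (R : realType) (n : nat) :
  achievable R n (U R n) /\
  forall l : nat, achievable R n l -> (U R n <= l)%N.
Proof.
rewrite /U; case: ex_minnP => m /asboolP am mmin; split=> // l al.
by apply: mmin; apply/asboolP.
Qed.

(* Main.v *)
Require Import Defs.
From mathcomp Require Import all_boot all_order all_algebra all_fingroup.
From mathcomp Require Import all_classical all_reals all_analysis.
From mathcomp Require Import ring lra zify.

(** Think of the points as the positions of a deck of cards. The deck is shuffled
    by induction: if n - 3 cards are already in uniformly random order, three
    new cards are inserted by a network that sends them to a uniformly random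
    triple of distinct positions, whatever it does to the other cards
    (uniform_on_insert, uniform_on_insert3). Inserting cards one at a time costs
    n - 1 swaps for the n-th card and 'C(n, 2) in total. Three cards together
    can be inserted with 2n + O(log n) swaps instead of 3n, which gives the
    factor 2/3.

    To spread three cards over 2x positions, arrange the positions in two rows
    of x, with the three cards in the first row. One swap, with the probability
    that a random 3-subset meets both rows, brings one of the cards to the
    second row. The cards in the first row are then spread over it recursively,
    and a card in the second row is spread over it by x - 1 swaps. Finally, in
    each of the x columns the two entries are exchanged with probability 1/2.
    These flips cannot tell the two rows apart (mean_flips), and this is what
    makes the resulting set of three positions uniform (sym_spread3_doubling).
    Three swaps at the very beginning put the three cards in random order
    (shuffle3_spread), so only the set has to be right. The cost D satisfies
    D(2x) = D(x) + 2x + 3, and an odd position costs 4 more swaps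
    (triple_cost_add); hence D(h) = 2h + O(log h) (triple_cost_log).

    For six positions, the recursion with x = 3 needs only a random set in the
    first row, so that D(6) = 11 suffices and six cards are shuffled with
    3 + 11 = 14 swaps, one less than 'C(6, 2). One-by-one insertion keeps the
    saving of one swap for larger n (shuffle_cost_lt_bin2), which is a positive
    proportion of 'C(n, 2) for n bounded; for large n the bound 2/3 'C(n, 2) +
    O(n log n) saves a positive proportion.

    A network is a list of triples, and its law is handled through the
    expectations of all functions of the random permutation. *)

Import Order.TTheory GRing.Theory Num.Theory.
Import numFieldNormedType.Exports.

Set Implicit Arguments.
Unset Strict Implicit.
Unset Printing Implicit Defensive.

Local Open Scope ring_scope.

(** * Networks of lazy transpositions *)

Section Networks.
Variables (R : realType) (V : finType).
Implicit Types (w : seq (V * V * R)) (f g : {perm V} -> R) (ks bs : seq V).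
Implicit Types (F : V -> V -> V -> R) (G : V -> V -> R).

(** The triple (a, b, p) stands for the lazy transposition of a and b with
    probability p, and ks lists the positions that the network may touch. *)
Definition network ks w :=
  all (fun x => [&& x.1.1 != x.1.2, 0 <= x.2 <= 1, x.1.1 \in ks & x.1.2 \in ks]) w.

(** The expectation of f at the random composition of the network, whose first
    entry acts first: s x is the final position of the card that starts at x. *)
Fixpoint mean w f : R :=
  if w is (a, b, p) :: w' then
    p * mean w' (fun s => f (tperm a b * s)%g) + (1 - p) * mean w' f
  else f 1%g.

Definition permutes ks (s : {perm V}) := perm_on [set x in ks] s.

Lemma permutes_fix ks s x : permutes ks s -> x \notin ks -> s x = x.
Proof. by move=> sk xk; apply: (out_perm sk); rewrite inE. Qed.

Lemma permutes_mem ks s x : permutes ks s -> (s x \in ks) = (x \in ks).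
Proof. by move=> sk; have := perm_closed x sk; rewrite !inE. Qed.

Lemma permutes_perm ks s : uniq ks -> permutes ks s -> perm_eq (map s ks) ks.
Proof.
move=> uk sk; apply: uniq_perm => //; first by rewrite map_inj_uniq //; exact: perm_inj.
move=> x; apply/mapP/idP => [[y yk ->]|xk]; first by rewrite permutes_mem.
by exists (s^-1 x)%g; rewrite ?permKV // -(permutes_mem _ sk) permKV.
Qed.

Lemma sub_network ks ks' w : {subset ks <= ks'} -> network ks w -> network ks' w.
Proof.
move=> h; apply: sub_all => x /and4P[-> -> /h -> /h ->]; by [].
Qed.

Lemma network_cat ks w1 w2 : network ks (w1 ++ w2) = network ks w1 && network ks w2.
Proof. exact: all_cat. Qed.

Lemma eq_mean_in ks w f g : network ks w ->
  (forall s, permutes ks s -> f s = g s) -> mean w f = mean w g.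
Proof.
elim: w f g => [|[[a b] p] w IH] f g /=; first by move=> _; apply; exact: perm_on1.
case/andP => /and4P[/= _ _ ak bk] nw fg; rewrite (IH f g) //; congr (_ * _ + _).
apply: (IH _ _ nw) => s sk; apply: fg; apply: perm_onM => //.
apply/fintype.subsetP => x; rewrite !inE.
by case: tpermP => [->|->|_ _] //; rewrite eqxx.
Qed.

Lemma eq_mean w f g : f =1 g -> mean w f = mean w g.
Proof.
elim: w f g => [|[[a b] p] w IH] f g fg /=; first by rewrite fg.
by rewrite (IH f g fg); congr (_ * _ + _); apply: IH => s; rewrite fg.
Qed.

Lemma mean_cat w1 w2 f :
  mean (w1 ++ w2) f = mean w1 (fun s => mean w2 (fun t => f (s * t)%g)).
Proof.
elim: w1 f => [|[[a b] p] w1 IH] f /=.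
  by apply: eq_mean => t; rewrite mul1g.
rewrite !IH; congr (_ * _ + _).
by apply: eq_mean => s; apply: eq_mean => t; rewrite mulgA.
Qed.

Lemma mean_const w (c : R) : mean w (fun=> c) = c.
Proof. by elim: w => [|[[a b] p] w IH] //=; rewrite IH; ring. Qed.

Lemma meanZ w (c : R) f : mean w (fun s => c * f s) = c * mean w f.
Proof.
elim: w f => [|[[a b] p] w IH] f //=.
by rewrite (IH (fun s => f (_ * s)%g)) IH; ring.
Qed.

Lemma meanD w f g : mean w (fun s => f s + g s) = mean w f + mean w g.
Proof.
elim: w f g => [|[[a b] p] w IH] f g //=.
by rewrite (IH (fun s => f (_ * s)%g)) IH; ring.
Qed.

Lemma mean_sum (I : Type) (r : seq I) (P : pred I) w (h : I -> {perm V} -> R) :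
  mean w (fun s => \sum_(i <- r | P i) h i s) = \sum_(i <- r | P i) mean w (h i).
Proof.
elim: r => [|i r IH].
  by rewrite big_nil -[RHS](mean_const w); apply: eq_mean => s; rewrite big_nil.
rewrite big_cons -IH; case: ifP => Pi; last first.
  by apply: eq_mean => s; rewrite big_cons Pi.
by rewrite -meanD; apply: eq_mean => s; rewrite big_cons Pi.
Qed.

Definition sum3 xs ys zs F : R :=
  \sum_(i <- xs) \sum_(j <- ys) \sum_(k <- zs) F i j k.

Definition total3 ks F := sum3 ks ks ks F.

(** Every permutation of ks merely reorders the terms of a sum over all triples
    of positions, so such sums survive averaging over a network. *)
Lemma mean_total ks w F : uniq ks -> network ks w ->
  total3 ks (fun i j k => mean w (fun s => F (s i) (s j) (s k))) = total3 ks F.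
Proof.
move=> uk nw; rewrite /total3 /sum3.
under eq_bigr do under eq_bigr do rewrite -mean_sum.
under eq_bigr do rewrite -mean_sum.
rewrite -mean_sum -[RHS](mean_const w); apply: eq_mean_in (nw) _ => s sk.
have re (h : V -> R) : \sum_(i <- ks) h (s i) = \sum_(i <- ks) h i.
  by rewrite -(big_map s xpredT) (perm_big _ (permutes_perm uk sk)).
rewrite (re (fun i => \sum_(j <- ks) \sum_(k <- ks) F i (s j) (s k))).
apply: eq_bigr => i _; rewrite (re (fun j => \sum_(k <- ks) F i j (s k))).
by apply: eq_bigr => j _; rewrite re.
Qed.

(** * Spreading a few cards *)

(** Test functions of the positions of three distinct cards: their values at
    triples with a repetition never matter, and are normalised to 0. *)
Definition diagonal_free F :=
  forall i j, [/\ F i i j = 0, F i j i = 0 & F j i i = 0].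

Definition symmetric3 F := forall i j k, F i j k = F j i k /\ F i j k = F i k j.

Definition arrangements3 n : R := n%:R * (n%:R - 1) * (n%:R - 2).

Definition spread1 ks a w := forall h : V -> R,
  mean w (fun s => h (s a)) = (\sum_(i <- ks) h i) / (size ks)%:R.

(** The two symmetric variants test only the unordered set of the final
    positions: the cards may still be in a biased order within this set. *)
Definition sym_spread2 ks a b w := forall G,
  (forall i j, G i j = G j i) -> (forall i, G i i = 0) ->
  mean w (fun s => G (s a) (s b)) =
  (\sum_(i <- ks) \sum_(j <- ks) G i j) / ((size ks)%:R * ((size ks)%:R - 1)).

(** The law of the final positions of three cards is tested against functions:
    F runs over all functions of triples of distinct positions. *)
Definition spread3 ks a b c w := forall F, diagonal_free F ->
  mean w (fun s => F (s a) (s b) (s c)) = total3 ks F / arrangements3 (size ks).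

Definition sym_spread3 ks a b c w := forall F, symmetric3 F -> diagonal_free F ->
  mean w (fun s => F (s a) (s b) (s c)) = total3 ks F / arrangements3 (size ks).

(** The card that starts at a is left at the head of bs with the probability
    1/n that is right for a deck of n positions; otherwise it is still at a and
    goes on with the n - 1 other positions. *)
Fixpoint star a bs : seq (V * V * R) :=
  if bs is b :: bs' then (a, b, (size bs').+2%:R^-1) :: star a bs' else [::].

Lemma size_star a bs : size (star a bs) = size bs.
Proof. by elim: bs => //= b bs ->. Qed.

Lemma inv01 n : 0 <= (n.+1%:R : R)^-1 <= 1.
Proof. by rewrite invr_ge0 ler0n /= invf_le1 // ler1n. Qed.

Lemma network_star a bs : a \notin bs -> network (a :: bs) (star a bs).
Proof.
elim: bs => //= b bs IH; rewrite inE negb_or => /andP[ab abs].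
rewrite ab inv01 !inE !eqxx orbT /=; apply: sub_network (IH abs) => x.
by rewrite !inE => /orP[->//|->]; rewrite !orbT.
Qed.

Lemma star_spread a bs : uniq (a :: bs) -> spread1 (a :: bs) a (star a bs).
Proof.
elim: bs => [|b bs IH] /=.
  by move=> _ h /=; rewrite big_seq1 divr1 perm1.
rewrite inE negb_or => /andP[/andP[ab abs] /andP[bbs ubs]] h /=.
rewrite IH /= ?abs //.
have -> : mean (star a bs) (fun s => h ((tperm a b * s)%g a)) = h b.
  rewrite -[RHS](mean_const (star a bs)).
  apply: eq_mean_in (network_star abs) _ => s sk.
  by rewrite permM tpermL (permutes_fix sk) // inE negb_or eq_sym ab.
rewrite !big_cons /=.
rewrite -!natr1; have : 0 <= (size bs)%:R :> R by [].
move: (size bs)%:R => n n0; field; lra.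
Qed.

End Networks.

(** * Ordering three cards *)

Section ThreeCards.
Variables (R : realType) (V : finType).
Implicit Types (w : seq (V * V * R)) (ks : seq V) (F : V -> V -> V -> R).

Lemma uniq3 (a b c : V) os : uniq [:: a, b, c & os] -> uniq [:: a; b; c].
Proof. by rewrite -[_ :: _]/([:: a; b; c] ++ os) cat_uniq => /andP[]. Qed.

Lemma uniq3P (a b c : V) :
  uniq [:: a; b; c] -> [/\ a != b, a != c & b != c].
Proof. by rewrite /= !inE !negb_or => /and3P[/andP[]]. Qed.

Lemma total3_swap ks F : total3 ks (fun i j k => F j i k) = total3 ks F.
Proof. by rewrite /total3 /sum3 exchange_big. Qed.

Lemma total3_rot ks F : total3 ks (fun i j k => F i k j) = total3 ks F.
Proof. by apply: eq_bigr => i _; rewrite exchange_big. Qed.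

Lemma total3D ks F F' :
  total3 ks (fun i j k => F i j k + F' i j k) = total3 ks F + total3 ks F'.
Proof.
rewrite /total3 /sum3 -big_split; apply: eq_bigr => i _; rewrite -big_split.
by apply: eq_bigr => j _; rewrite -big_split.
Qed.

Lemma spread3_sym ks a b c w : spread3 ks a b c w -> sym_spread3 ks a b c w.
Proof. by move=> sp F _; apply: sp. Qed.

(** A symmetric function of the positions of two cards is a function of three
    positions that ignores the last one, except that it has to vanish when the
    last position repeats one of the others; summing over the n - 2 remaining
    positions turns n(n - 1)(n - 2) into n(n - 1). *)
Lemma spread3_sym2 ks a b c w : uniq ks -> a != c -> b != c -> (3 <= size ks)%N ->
  spread3 ks a b c w -> sym_spread2 ks a b w.
Proof.
move=> uk ac bc k3 sp G Gs G0.
pose F i j k := if (k == i) || (k == j) then 0 else G i j.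
have -> : mean w (fun s => G (s a) (s b)) = mean w (fun s => F (s a) (s b) (s c)).
  apply: eq_mean => s; rewrite /F !(inj_eq perm_inj) ![c == _]eq_sym.
  by rewrite (negbTE ac) (negbTE bc).
rewrite sp; last first.
  by move=> i j; rewrite /F !eqxx ?orbT; split => //; case: ifP.
have -> : total3 ks F = (\sum_(i <- ks) \sum_(j <- ks) G i j) * ((size ks)%:R - 2).
  rewrite /total3 /sum3 big_distrl /= big_seq [RHS]big_seq; apply: eq_bigr => i ik.
  rewrite big_distrl /= big_seq [RHS]big_seq; apply: eq_bigr => j jk.
  have [->|ij] := eqVneq i j; first by rewrite G0 mul0r big1 // => k _; rewrite /F G0; case: ifP.
  rewrite (eq_bigr (fun k => if (k != i) && (k != j) then G i j else 0)); last first.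
    by move=> k _; rewrite /F -negb_or; case: ifP.
  rewrite -big_mkcond big_const_seq iter_addr_0 -[LHS]mulr_natr; congr (_ * _).
  have /(congr1 (fun n : nat => n%:R : R)) :
      (count (fun k => (k != i) && (k != j)) ks + 2 = size ks)%N.
    rewrite -(count_predC (fun k => (k != i) && (k != j)) ks); congr addn.
    rewrite -[RHS](@eq_count _ (predU (pred1 i) (pred1 j))); last first.
      by move=> k /=; rewrite negb_and !negbK.
    have := count_predUI (pred1 i) (pred1 j) ks.
    rewrite !count_uniq_mem // ik jk (@eq_count _ (predI _ _) pred0) ?count_pred0 ?addn0 //.
    by move=> k /=; apply/negP => /andP[/eqP -> /eqP]; move/eqP: ij.
  by rewrite natrD => <-; rewrite addrK.
have : 3 <= (size ks)%:R :> R by rewrite ler_nat.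
rewrite /arrangements3; move: (size ks)%:R => n n3.
field; lra.
Qed.

(** Three swaps that put three cards in uniformly random order: the middle swap
    sends to c one of the three cards, all three being equally likely because
    2/3 = 2 * 1/3 and the first swap is fair. *)
Definition shuffle3 (a b c : V) : seq (V * V * R) :=
  [:: (a, b, 1 / 2); (b, c, 2 / 3); (a, b, 1 / 2)].

Lemma network_shuffle3 a b c os : uniq [:: a, b, c & os] ->
  network [:: a, b, c & os] (shuffle3 a b c).
Proof.
rewrite /= !inE !negb_or => /and3P[/and3P[ab ac _] /andP[bc _] _].
by rewrite ab bc !eqxx ?orbT /= !andbT; lra.
Qed.

(** Ordering the three cards at random beforehand replaces F by the average of
    its six reorderings, which is symmetric and has the same total. Hence it
    is enough to make the set of the three final positions uniform. *)
Lemma shuffle3_spread ks a b c w : uniq [:: a; b; c] ->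
  sym_spread3 ks a b c w -> spread3 ks a b c (shuffle3 a b c ++ w).
Proof.
move=> u3 sp F F0.
have [ab ac bc] := uniq3P u3.
have [ba ca cb] : [/\ b != a, c != a & c != b] by rewrite ![_ == a]eq_sym [c == b]eq_sym.
pose F' i j k := F i j k + F j i k + F i k j + F j k i + F k i j + F k j i.
have F's : symmetric3 F' by move=> i j k; rewrite /F'; split; ring.
have F'0 : diagonal_free F'.
  move=> i j; rewrite /F'; have [-> -> ->] := F0 i j;
  by split; ring.
have -> : total3 ks F = total3 ks F' / 6.
  rewrite /F' !total3D.
  have e1 := total3_swap ks F; have e2 := total3_rot ks F.
  have e3 := total3_rot ks (fun i j k => F j i k).
  have e4 := total3_swap ks (fun i j k => F i k j).
  have e5 := total3_rot ks (fun i j k => F j k i).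
  rewrite /= in e3 e4 e5.
  by rewrite e5 e4 e3 e2 e1; field.
rewrite mulrAC -(sp _ F's F'0).
rewrite [LHS]mean_cat /F' !meanD.
pose E i j k := mean w (fun s => F (s i) (s j) (s k)).
rewrite (@eq_mean _ _ (shuffle3 a b c) _ (fun u => E (u a) (u b) (u c))); last first.
  by move=> u; apply: eq_mean => s; rewrite !permM.
rewrite /= !mulg1 !permM !perm1.
have Dt (x y z : V) : x != z -> y != z -> tperm x y z = z by exact: tpermD.
rewrite ?(tpermL, tpermR) ?(Dt b c a) ?(Dt a b c) // ?(tpermL, tpermR) ?(Dt b c a) ?(Dt a b c) // ?(tpermL, tpermR) //.
by rewrite /E; field.
Qed.

End ThreeCards.

(** * Enlarging the deck by one position *)

Section OneMorePosition.
Variables (R : realType) (V : finType).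
Implicit Types (w : seq (V * V * R)) (ks : seq V) (F : V -> V -> V -> R).

(** The 8 blocks of triples over two rows, grouped by how many of the three
    positions lie in each row. *)
Lemma total3_cat xs ys F : symmetric3 F ->
  total3 (xs ++ ys) F =
  total3 xs F + 3 * sum3 xs xs ys F + 3 * sum3 ys ys xs F + total3 ys F.
Proof.
move=> Fs.
have s12 A B C : sum3 A B C F = sum3 B A C F.
  rewrite /sum3 exchange_big; apply: eq_bigr => j _; apply: eq_bigr => i _.
  by apply: eq_bigr => k _; have [->] := Fs i j k.
have s23 A B C : sum3 A B C F = sum3 A C B F.
  apply: eq_bigr => i _; rewrite exchange_big; apply: eq_bigr => j _.
  by apply: eq_bigr => k _; have [_ ->] := Fs i k j.
have c3 A B C D : sum3 A B (C ++ D) F = sum3 A B C F + sum3 A B D F.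
  rewrite /sum3 -big_split; apply: eq_bigr => i _; rewrite -big_split.
  by apply: eq_bigr => j _; rewrite big_cat.
have c2 A B C D : sum3 A (B ++ C) D F = sum3 A B D F + sum3 A C D F.
  by rewrite s23 c3 !(s23 A D).
have c1 A B C D : sum3 (A ++ B) C D F = sum3 A C D F + sum3 B C D F.
  by rewrite s12 c2 !(s12 C).
rewrite /total3 c3 !c2 !c1.
rewrite (s23 xs ys xs) (s12 ys xs xs) (s23 xs ys xs) (s12 xs ys ys) (s23 ys xs ys).
ring.
Qed.

Lemma mean_tperm_last w F a b c u : a != c -> b != c -> a != u -> b != u ->
  mean w (fun s => F ((tperm c u * s)%g a) ((tperm c u * s)%g b) ((tperm c u * s)%g c)) =
  mean w (fun s => F (s a) (s b) (s u)).
Proof.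
move=> ac bc au bu; apply: eq_mean => s; rewrite !permM tpermL !tpermD // eq_sym //.
Qed.

Lemma perm_total3 ks ks' F : perm_eq ks ks' -> total3 ks F = total3 ks' F.
Proof.
move=> e; rewrite /total3 /sum3 (perm_big _ e); apply: eq_bigr => i _.
by rewrite (perm_big _ e); apply: eq_bigr => j _; rewrite (perm_big _ e).
Qed.

(** A random 3-subset of n positions contains the given position u with
    probability 3/n, and otherwise is a random 3-subset of the other positions.
    The first swap brings the card c to u with this probability; the network w
    then spreads the two or three cards that it still finds in ks. *)
Lemma sym_spread3_add ks u a b c w : uniq [:: a; b; c] -> uniq (u :: ks) ->
  {subset [:: a; b; c] <= ks} -> network ks w -> spread3 ks a b c w ->
  sym_spread3 (u :: ks) a b c ((c, u, 3 / (size ks).+1%:R) :: w).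
Proof.
move=> u3 /andP[uks uk] sub nw sp F Fs F0.
have [ab ac bc] := uniq3P u3.
have [ak bk ck] : [/\ a \in ks, b \in ks & c \in ks].
  by split; apply: sub; rewrite !inE eqxx ?orbT.
have k3 : (3 <= size ks)%N by apply: (uniq_leq_size u3 sub).
have nu x : x \in ks -> x != u by move=> xk; apply: contraNneq uks => <-.
rewrite /= mean_tperm_last ?nu // (eq_mean_in (g := fun s => F (s a) (s b) u) nw); last first.
  by move=> s sk; rewrite (permutes_fix sk uks).
rewrite (spread3_sym2 uk ac bc k3 sp (G := fun i j => F i j u)); last first.
- by move=> i; have [->] := F0 i u.
- by move=> i j; have [->] := Fs i j u.
rewrite (spread3_sym sp Fs F0).
have -> : total3 (u :: ks) F = total3 ks F + 3 * \sum_(i <- ks) \sum_(j <- ks) F i j u.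
  rewrite (@perm_total3 _ (ks ++ [:: u])); last by rewrite cats1 perm_sym perm_rcons.
  rewrite total3_cat // [total3 [:: u] _]big_seq1 !big_seq1.
  have [-> _ _] := F0 u u.
  have -> : sum3 [:: u] [:: u] ks F = 0.
    rewrite /sum3 !big_seq1 big1 // => k _; by have [->] := F0 u k.
  rewrite !addr0 mulr0 addr0; congr (_ + _ * _).
  by apply: eq_bigr => i _; apply: eq_bigr => j _; rewrite big_seq1.
have : 3 <= (size ks)%:R :> R by rewrite ler_nat.
rewrite /arrangements3 /= -(natr1 (size ks)); move: (size ks)%:R => n n3.
move: (total3 _ _) (\sum_(i <- ks) _) => A B.
field; lra.
Qed.

End OneMorePosition.

(** * Flipping the columns of two rows *)

Section Flips.
Variables (R : realType) (V : finType).
Implicit Types (l : seq (V * V)) (f : {perm V} -> R).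

(** The pairs in l are the columns of an array with two rows. *)
Definition flips l : seq (V * V * R) := [seq (x, 1 / 2) | x <- l].

Definition flip_all l : {perm V} := (\prod_(x <- l) tperm x.1 x.2)%g.

Lemma flip_all_fix l z : z \notin unzip1 l ++ unzip2 l -> flip_all l z = z.
Proof.
elim: l => [|[x y] l IH]; first by rewrite /flip_all big_nil perm1.
rewrite /= inE mem_cat inE !negb_or => /and4P[zx zl zy zl'].
rewrite /flip_all big_cons permM /= tpermD 1?eq_sym //; apply: IH.
by rewrite mem_cat negb_or zl.
Qed.

Lemma uniq_pairs_cons x y l : uniq (unzip1 ((x, y) :: l) ++ unzip2 ((x, y) :: l)) =
  [&& x != y, x \notin unzip1 l ++ unzip2 l, y \notin unzip1 l ++ unzip2 l
    & uniq (unzip1 l ++ unzip2 l)].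
Proof.
rewrite /= (perm_uniq (permEl (perm_catCA (unzip1 l) [:: y] (unzip2 l)))) /=.
by rewrite !mem_cat inE; case: (x == y); case: (x \in _); case: (x \in _).
Qed.

(** Exchanging the two rows as a whole is invisible after the fair flips: it
    only renames the two equally likely outcomes of each flip. *)
Lemma mean_flips l f : uniq (unzip1 l ++ unzip2 l) ->
  mean (flips l) (fun s => f (flip_all l * s)%g) = mean (flips l) f.
Proof.
elim: l f => [|[x y] l IH] f.
  by rewrite /= /flip_all big_nil mulg1.
rewrite uniq_pairs_cons => /and4P[xy xl yl ul] /=.
set t := tperm x y; set r := flip_all l.
have -> : flip_all ((x, y) :: l) = (t * r)%g by rewrite /flip_all big_cons.
have tr : (t * r = r * t)%g.
  apply/commgP/conjg_fixP; rewrite tpermJ.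
  by rewrite !flip_all_fix.
rewrite (@eq_mean _ _ _ _ (fun s => f (r * s)%g)); last first.
  by move=> s; rewrite tr -!mulgA (mulgA t t) tperm2 mul1g.
have -> : mean (flips l) (fun s => f (t * r * s)%g) = mean (flips l) (fun s => f (t * s)%g).
  rewrite -(IH (fun s => f (t * s)%g) ul).
  by apply: eq_mean => s; rewrite mulgA.
by rewrite (IH f ul); field.
Qed.

Lemma flip_all_map l : uniq (unzip1 l ++ unzip2 l) ->
  map (flip_all l) (unzip1 l) = unzip2 l /\ map (flip_all l) (unzip2 l) = unzip1 l.
Proof.
elim: l => // [[x y] l IH]; rewrite uniq_pairs_cons => /and4P[xy xl yl ul].
have [e1 e2] := IH ul.
have fl z : z \in unzip1 l ++ unzip2 l -> flip_all ((x, y) :: l) z = flip_all l z.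
  move=> zl; rewrite /flip_all big_cons permM /= tpermD //.
    by apply: contraNneq xl => ->.
  by apply: contraNneq yl => ->.
have fx : flip_all ((x, y) :: l) x = y.
  by rewrite /flip_all big_cons permM /= tpermL [LHS]flip_all_fix.
have fy : flip_all ((x, y) :: l) y = x.
  by rewrite /flip_all big_cons permM /= tpermR [LHS]flip_all_fix.
split; rewrite /= ?fx ?fy; congr cons; [rewrite -[RHS]e1|rewrite -[RHS]e2];
  by apply/eq_in_map => z zl; apply: fl; rewrite mem_cat zl ?orbT.
Qed.

End Flips.

(** * Doubling the deck *)

Section Doubling.
Variables (R : realType) (V : finType).
Implicit Types (w : seq (V * V * R)) (ks : seq V) (F : V -> V -> V -> R).

(** The rows hs and d :: ds form a deck of 2x positions, and the three cards
    start in hs. The probability in the first swap, 3x / (2(2x - 1)), is that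
    of a random 3-subset of the deck not to lie within one row. *)
Definition doubling hs d ds c w : seq (V * V * R) :=
  (c, d, 3 * (size hs)%:R / (2 * (2 * (size hs)%:R - 1))) ::
  w ++ star R d ds ++ flips R (zip hs (d :: ds)).

Lemma size_doubling hs d ds c w : size hs = (size ds).+1 ->
  size (doubling hs d ds c w) = (size w + 2 * size hs)%N.
Proof.
move=> e; rewrite /doubling -cat1s !size_cat size_star size_map size_zip /= -e minnn; lia.
Qed.

Lemma network_flips (l : seq (V * V)) : uniq (unzip1 l ++ unzip2 l) ->
  network (unzip1 l ++ unzip2 l) (flips R l).
Proof.
elim: l => // -[x y] l IH; rewrite uniq_pairs_cons => /and4P[xy _ _ ul].
rewrite /= xy !(mem_cat, inE) !eqxx !orbT /=; apply/andP; split; first lra.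
apply: sub_network (IH ul) => z; rewrite mem_cat in_cons mem_cat in_cons.
by case/orP=> ->; rewrite ?orbT.
Qed.

Lemma network_doubling hs d ds c w : uniq (hs ++ d :: ds) ->
  size hs = (size ds).+1 -> (2 <= size hs)%N -> c \in hs -> network hs w ->
  network (hs ++ d :: ds) (doubling hs d ds c w).
Proof.
move=> us e k2 ck nw.
have [uh [disj udd]] : uniq hs /\ ~~ has (mem hs) (d :: ds) /\ uniq (d :: ds).
  by move: us; rewrite cat_uniq => /and3P[].
have cd : c != d.
  by apply: contraNneq disj => <-; apply/hasP; exists c; rewrite ?inE ?eqxx.
have ez1 : unzip1 (zip hs (d :: ds)) = hs by rewrite unzip1_zip //= e.
have ez2 : unzip2 (zip hs (d :: ds)) = d :: ds by rewrite unzip2_zip //= e.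
rewrite /doubling; set L := flips _ _.
rewrite /= cd !(mem_cat, inE) ck eqxx !orbT /= andbT; apply/andP; split.
  have : 2 <= (size hs)%:R :> R by rewrite ler_nat.
  move: (size hs)%:R => x x2; rewrite divr_ge0 ?ler_pdivrMr; lra.
rewrite !network_cat; apply/and3P; split.
- by apply: sub_network nw => z zh; rewrite mem_cat zh.
- apply: (@sub_network _ _ (d :: ds)).
    by move=> z zh; rewrite mem_cat zh orbT.
  by apply: network_star; case/andP: udd.
- by have := @network_flips (zip hs (d :: ds)); rewrite ez1 ez2; apply.
Qed.

(** Before the flips, the set of the three positions is uniform among the
    3-subsets of the first row with probability 1 - p, and uniform among the
    sets with two elements in the first row and one in the second with
    probability p. By the choice of p, exchanging the rows with probability 1/2
    would make it uniform among all 3-subsets, and the flips preserve this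
    uniform law. But the flips make this exchange invisible, so it can be
    omitted. *)
Lemma sym_spread3_doubling hs d ds a b c w : uniq (hs ++ d :: ds) ->
  size hs = (size ds).+1 -> uniq [:: a; b; c] -> {subset [:: a; b; c] <= hs} ->
  network hs w -> sym_spread3 hs a b c w -> sym_spread2 hs a b w ->
  sym_spread3 (hs ++ d :: ds) a b c (doubling hs d ds c w).
Proof.
move=> us e u3 sub nw sp3 sp2 F Fs F0.
have [uh [disj udd]] : uniq hs /\ ~~ has (mem hs) (d :: ds) /\ uniq (d :: ds).
  by move: us; rewrite cat_uniq => /and3P[].
have [ab ac bc] := uniq3P u3.
have [ak bk ck] : [/\ a \in hs, b \in hs & c \in hs].
  by split; apply: sub; rewrite !inE eqxx ?orbT.
have k3 : (3 <= size hs)%N by apply: (uniq_leq_size u3 sub).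
have notin x : x \in hs -> x \notin d :: ds.
  by move=> xh; apply: contra disj => xd; apply/hasP; exists x.
have notin' x : x \in d :: ds -> x \notin hs.
  by move=> xh; apply: contra disj => xd; apply/hasP; exists x.
have nd x : x \in hs -> x != d by move=> /notin; rewrite inE negb_or => /andP[].
pose hs' := d :: ds.
set L := flips R (zip hs hs').
(* What F becomes when it is tested before the flips. *)
pose P i j k := mean L (fun s => F (s i) (s j) (s k)).
have Ps : symmetric3 P.
  by move=> i j k; split; apply: eq_mean => s; have [] := Fs (s i) (s j) (s k).
have P0 : diagonal_free P.
  by move=> i j; split; rewrite -[RHS](mean_const L); apply: eq_mean => s;
     have [] := F0 (s i) (s j).
have ez1 : unzip1 (zip hs hs') = hs by rewrite unzip1_zip //= e.
have ez2 : unzip2 (zip hs hs') = hs' by rewrite unzip2_zip //= e.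
have uz : uniq (unzip1 (zip hs hs') ++ unzip2 (zip hs hs')) by rewrite ez1 ez2.
have nL : network (hs ++ hs') L.
  by have := network_flips uz; rewrite ez1 ez2.
pose r := flip_all (zip hs hs').
have Pr i j k : P (r i) (r j) (r k) = P i j k.
  rewrite /P -[RHS](mean_flips (fun s => F (s i) (s j) (s k)) uz).
  by apply: eq_mean => s; rewrite !permM.
have [rh rh'] : map r hs = hs' /\ map r hs' = hs.
  by have := flip_all_map uz; rewrite ez1 ez2.
have sumr A B C : sum3 (map r A) (map r B) (map r C) P = sum3 A B C P.
  rewrite /sum3 big_map; apply: eq_bigr => i _; rewrite big_map.
  by apply: eq_bigr => j _; rewrite big_map; apply: eq_bigr => k _.
(* The six mixed blocks agree by symmetry and by the exchange of the rows. *)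
have totF : total3 (hs ++ hs') F = 2 * total3 hs P + 6 * sum3 hs hs hs' P.
  rewrite -(mean_total F us nL) -/P total3_cat //.
  have -> : total3 hs' P = total3 hs P by rewrite -[RHS]sumr rh.
  have -> : sum3 hs' hs' hs P = sum3 hs hs hs' P by rewrite -[RHS]sumr rh rh'.
  ring.
have nS : network hs' (star R d ds) by apply: network_star; case/andP: udd.
rewrite /doubling -/hs' -/L /= mean_tperm_last ?nd // !mean_cat.
have -> : mean w (fun s1 => mean (star R d ds ++ L) (fun t =>
    F ((s1 * t)%g a) ((s1 * t)%g b) ((s1 * t)%g c))) =
  mean w (fun s => P (s a) (s b) (s c)).
  apply: eq_mean_in nw _ => s sk; rewrite mean_cat -[RHS](mean_const (star R d ds)).
  apply: eq_mean_in nS _ => t tk; apply: eq_mean => u; rewrite !permM.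
  have ts x : x \in hs -> t (s x) = s x.
    by move=> xh; apply: permutes_fix tk _; apply: notin; rewrite (permutes_mem _ sk).
  rewrite !ts //.
have -> : mean w (fun s1 => mean (star R d ds ++ L) (fun t =>
    F ((s1 * t)%g a) ((s1 * t)%g b) ((s1 * t)%g d))) =
  mean w (fun s => (\sum_(k <- hs') P (s a) (s b) k) / (size hs)%:R).
  apply: eq_mean_in nw _ => s sk; rewrite mean_cat.
  have -> : (size hs) = size hs' by rewrite e.
  rewrite -(star_spread udd (P (s a) (s b))).
  apply: eq_mean_in nS _ => t tk; apply: eq_mean => u; rewrite !permM.
  have -> : s d = d by apply: permutes_fix sk _; apply: notin'; rewrite inE eqxx.
  have ts x : x \in hs -> t (s x) = s x.
    by move=> xh; apply: permutes_fix tk _; apply: notin; rewrite (permutes_mem _ sk).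
  rewrite !ts //.
rewrite (sp3 P Ps P0) (sp2 (fun i j => (\sum_(k <- hs') P i j k) / (size hs)%:R)); last first.
- by move=> i; rewrite big1 ?mul0r // => k _; have [] := P0 i k.
- by move=> i j; congr (_ / _); apply: eq_bigr => k _; have [] := Ps i j k.
have -> : \sum_(i <- hs) \sum_(j <- hs) (\sum_(k <- hs') P i j k) / (size hs)%:R =
    sum3 hs hs hs' P / (size hs)%:R.
  by rewrite big_distrl; apply: eq_bigr => i _; rewrite big_distrl.
rewrite totF /arrangements3 size_cat /= -e natrD.
have : 3 <= (size hs)%:R :> R by rewrite ler_nat.
move: (total3 hs P) (sum3 hs hs hs' P) (size hs)%:R; clear=> A B n n3.
field; lra.
Qed.

End Doubling.

(** * Cost of spreading three cards *)

Section TripleCost.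
Variables (R : realType) (V : finType).
Implicit Types (w : seq (V * V * R)) (ks : seq V) (F : V -> V -> V -> R).

Definition triple_cost (x l : nat) := forall a b c os,
  uniq [:: a, b, c & os] -> size [:: a, b, c & os] = x ->
  exists w, [/\ network [:: a, b, c & os] w, size w = l
              & spread3 [:: a, b, c & os] a b c w].

Definition sym_triple_cost (x l : nat) := forall a b c os,
  uniq [:: a, b, c & os] -> size [:: a, b, c & os] = x ->
  exists w, [/\ network [:: a, b, c & os] w, size w = l,
                sym_spread3 [:: a, b, c & os] a b c w
              & sym_spread2 [:: a, b, c & os] a b w].

Lemma triple_cost_sym x l : triple_cost x l -> sym_triple_cost x l.
Proof.
move=> T a b c os u e; have [w [nw sw sp]] := T _ _ _ _ u e.
exists w; split=> //; first exact: spread3_sym.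
have [ab ac bc] := uniq3P (uniq3 u).
exact: spread3_sym2 sp.
Qed.

Lemma ordering_step (a b c : V) os w : uniq [:: a, b, c & os] ->
  network [:: a, b, c & os] w -> sym_spread3 [:: a, b, c & os] a b c w ->
  exists w', [/\ network [:: a, b, c & os] w', size w' = (size w + 3)%N
              & spread3 [:: a, b, c & os] a b c w'].
Proof.
move=> u nw sp; exists (shuffle3 R a b c ++ w); split.
- by rewrite network_cat network_shuffle3.
- by rewrite size_cat addnC.
- by apply: shuffle3_spread sp; exact: uniq3 u.
Qed.

Lemma total3_triple F (a b c : V) : symmetric3 F -> diagonal_free F ->
  total3 [:: a; b; c] F = 6 * F a b c.
Proof.
move=> Fs F0; rewrite /total3 /sum3 !big_cons !big_nil.
have D1 x y : F x x y = 0 by have [] := F0 x y.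
have D2 x y : F x y x = 0 by have [] := F0 x y.
have D3 x y : F y x x = 0 by have [] := F0 x y.
rewrite !D1 !D2 !D3.
have [e1 e2] := Fs a b c; have [_ e3] := Fs b a c.
have [e4 _] := Fs a c b; have [_ e6] := Fs c a b.
by rewrite -e6 -e4 -e3 -e2 -e1; ring.
Qed.

Lemma triple_cost3 : triple_cost 3 3.
Proof.
move=> a b c [|//] u _; apply: (@ordering_step _ _ _ _ [::]) => // F Fs F0 /=.
by rewrite !perm1 total3_triple // /arrangements3; field.
Qed.

Lemma sym_spread3_perm ks ks' a b c w : perm_eq ks ks' ->
  sym_spread3 ks a b c w -> sym_spread3 ks' a b c w.
Proof.
by move=> e sp F Fs F0; rewrite -(perm_total3 _ e) -(perm_size e); exact: sp.
Qed.

Lemma triple_cost_add x l : (3 <= x)%N -> triple_cost x l ->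
  triple_cost x.+1 (l + 4).
Proof.
move=> x3 T a b c [|u os]; first by move=> _ /= e; exfalso; lia.
have e : perm_eq (u :: [:: a, b, c & os]) [:: a, b, c, u & os].
  by rewrite -[u :: _]/([:: u] ++ [:: a; b; c] ++ os) perm_catCA.
move=> un; have := un; rewrite -(perm_uniq e) => un' /= [sx].
have [uos un2] : u \notin [:: a, b, c & os] /\ uniq [:: a, b, c & os] by apply/andP.
have [w [nw sw sp]] := T _ _ _ _ un2 sx.
have sub : {subset [:: a; b; c] <= [:: a, b, c & os]}.
  by move=> z; rewrite -[[:: a, b, c & os]]/([:: a; b; c] ++ os) mem_cat => ->.
have nc : network [:: a, b, c, u & os] ((c, u, 3 / (size [:: a, b, c & os]).+1%:R) :: w).
  rewrite /= !inE !eqxx !orbT /= andbT. apply/andP; split; first (apply/andP; split).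
  - by apply: contraNneq uos => <-; rewrite !inE eqxx !orbT.
  - rewrite divr_ge0 //= ler_pdivrMr ?ltr0n // mul1r ler_nat; lia.
  apply: sub_network nw => z zk; rewrite -(perm_mem e) inE zk orbT //.
have [] := @ordering_step a b c (u :: os) _ un nc.
  apply: sym_spread3_perm e _; apply: sym_spread3_add => //; exact: uniq3 un.
by move=> w' [nw' sw' sp']; exists w'; split=> //; rewrite sw' /= sw; lia.
Qed.

(** The count is 1 + l + (x - 1) + x for the network of the doubling, and 3 for
    the ordering. *)
Lemma triple_cost_double x l : (3 <= x)%N -> sym_triple_cost x l ->
  triple_cost (2 * x) (l + 2 * x + 3).
Proof.
move=> x3 T a b c os un sos.
pose r := take (x - 3) os.
have eos : os = r ++ drop (x - 3) os by rewrite cat_take_drop.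
have so : size os = (2 * x - 3)%N by move: sos => /=; lia.
have sr : size r = (x - 3)%N by rewrite size_takel // so; lia.
have : size (drop (x - 3) os) = x by rewrite size_drop so; lia.
case: (drop (x - 3) os) eos => [|d ds] eos sd; first by rewrite /= in sd; lia.
pose hs := [:: a, b, c & r].
have shs : size hs = x by rewrite /= sr; lia.
have ek : [:: a, b, c & os] = hs ++ d :: ds by rewrite eos.
have sub : {subset [:: a; b; c] <= hs}.
  by move=> z; rewrite /hs -[[:: a, b, c & r]]/([:: a; b; c] ++ r) mem_cat => ->.
have uh : uniq hs by move: un; rewrite ek cat_uniq => /andP[].
have [w [nw sw sp3 sp2]] := T _ _ _ _ uh shs.
have e : size hs = (size ds).+1 by rewrite shs -sd.
have := @ordering_step a b c os (doubling hs d ds c w) un.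
case.
- rewrite ek; apply: network_doubling => //; rewrite -?ek //.
  by apply: sub; rewrite !inE eqxx !orbT.
- rewrite ek; apply: sym_spread3_doubling => //; rewrite -?ek //; exact: uniq3 un.
by move=> w' [nw' sw' sp']; exists w'; split=> //; rewrite sw' size_doubling // sw shs.
Qed.

(** On three positions the set is determined, and only the pair of the
    positions of a and b has to be random, that is, the position of c: a star
    of two swaps suffices. This saves one swap in the deck of six positions,
    compared with ordering the three cards completely. *)
Lemma sym_triple_cost3 : sym_triple_cost 3 2.
Proof.
move=> a b c [|//] u _.
have [ab ac bc] := uniq3P u.
have [ba ca cb] : [/\ b != a, c != a & c != b] by rewrite ![_ == a]eq_sym [c == b]eq_sym.
have Dt (x y z : V) : x != z -> y != z -> tperm x y z = z by exact: tpermD.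
exists [:: (c, a, 1 / 3); (c, b, 1 / 2)]; split.
- rewrite /= !inE !eqxx !orbT /= ca cb /=; lra.
- by [].
- move=> F Fs F0 /=.
  rewrite !mulg1 !permM !perm1.
  rewrite ?(tpermL, tpermR) ?(Dt c a b) ?(Dt c b a) // ?(tpermL, tpermR) ?(Dt c a b) ?(Dt c b a) //.
  rewrite total3_triple //.
  have [e1 e2] := Fs a b c; have [_ e3] := Fs b a c.
  have [e4 _] := Fs a c b; have [_ e6] := Fs c a b.
  by rewrite -e6 -e4 -e3 -e2 -e1 /arrangements3; field.
move=> G Gs G0 /=.
rewrite !mulg1 !permM !perm1.
rewrite ?(tpermL, tpermR) ?(Dt c a b) ?(Dt c b a) // ?(tpermL, tpermR) ?(Dt c a b) ?(Dt c b a) //.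
rewrite !big_cons !big_nil !G0 (Gs b a) (Gs c a) (Gs c b).
by field.
Qed.

(** Halving h costs h + 3 swaps, or h + 6 when h is odd, since a leftover
    position costs 4. The main terms form the geometric sum h + h/2 + ..., and
    there are at most trunc_log 2 h halvings. *)
Lemma triple_cost_log h : (3 <= h)%N ->
  exists2 l, (l <= 2 * h + 7 * trunc_log 2 h)%N & triple_cost h l.
Proof.
have [n] := ubnP h; elim: n h => // n IH h hn h3.
have [h6|h6] := ltnP h 6.
  have l1 : (1 <= trunc_log 2 h)%N by apply: trunc_log_max => //; exact: ltnW.
  have t3 := triple_cost3.
  have t4 : triple_cost 4 7 := triple_cost_add (leqnn 3) t3.
  have t5 : triple_cost 5 11 := triple_cost_add (isT : (3 <= 4)%N) t4.
  have : (h == 3) || (h == 4) || (h == 5) by lia.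
  case/orP => [/orP[]|] /eqP eh; subst h.
  - by exists 3%N.
  - by exists 7%N.
  - by exists 11%N.
have x3 : (3 <= h./2)%N by lia.
have [|l ll t] := IH h./2 _ x3; first by lia.
have t2 := triple_cost_double x3 (triple_cost_sym t).
have Lx : trunc_log 2 h = (trunc_log 2 h./2).+1.
  by rewrite trunc_log2S //; lia.
case: (boolP (odd h)) => oh.
  exists (l + 2 * h./2 + 3 + 4)%N; first by rewrite Lx; lia.
  have e : h = (2 * h./2).+1 by lia.
  by rewrite {1}e; apply: triple_cost_add t2; lia.
exists (l + 2 * h./2 + 3)%N; first by rewrite Lx; lia.
have e : h = (2 * h./2)%N by lia.
by rewrite {1}e.
Qed.

End TripleCost.

(** * Inserting new cards into a shuffled deck *)

Section Shuffles.
Variables (R : realType) (V : finType).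
Implicit Types (w v : seq (V * V * R)) (f : {perm V} -> R) (ks news : seq V).

Definition uniform_on ks w := forall f : {perm V} -> R,
  mean w f = (\sum_(s | permutes ks s) f s) / (size ks)`!%:R.

(** The coset of the permutations of ks that contains t is the set of the
    permutations of the whole deck that send the new cards where t does. *)
Lemma permutes_coset news ks (s t : {perm V}) : permutes (news ++ ks) t ->
  {in news, forall x, x \notin ks} ->
  permutes ks (s * t^-1) = permutes (news ++ ks) s && (map s news == map t news).
Proof.
move=> tk nk.
apply/idP/andP => [stk|[sk /eqP/eq_in_map e]].
  split; last first.
    apply/eqP/eq_in_map => x xn; have := permutes_fix stk (nk x xn).
    by rewrite permM => /(congr1 t); rewrite permKV.
  rewrite -(mulgKV t s); apply: perm_onM => //.
  apply: fintype.subset_trans stk _; apply/fintype.subsetP => x.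
  by rewrite !inE mem_cat => ->; rewrite orbT.
apply/fintype.subsetP => x; rewrite !inE permM; apply: contraNT => xk.
apply/eqP; have [xn|xn] := boolP (x \in news); first by rewrite e // permK.
have xnk : x \notin news ++ ks by rewrite mem_cat negb_or xn.
by rewrite (permutes_fix sk) // -{1}(permutes_fix tk xnk) permK.
Qed.

(** A deck is uniformly shuffled if the old cards are shuffled among themselves
    and the positions of the new cards are then made uniform: the first step
    makes the law uniform on each coset, the second one on the set of cosets. *)
Lemma uniform_on_insert news ks w v : uniq (news ++ ks) ->
  uniform_on ks w -> network (news ++ ks) v ->
  (forall f, mean v (fun t =>
     \sum_(s | permutes (news ++ ks) s && (map s news == map t news)) f s) =
     (\sum_(s | permutes (news ++ ks) s) f s) *
       ((size ks)`!%:R / (size (news ++ ks))`!%:R)) ->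
  uniform_on (news ++ ks) (w ++ v).
Proof.
move=> un uw nv sp f; rewrite mean_cat uw -mean_sum.
have nk : {in news, forall x, x \notin ks}.
  move=> x xn; move: un; rewrite cat_uniq => /and3P[_ /hasPn h _].
  by apply/negP => /h; rewrite /= xn.
rewrite (eq_mean_in (g := fun t =>
  \sum_(s | permutes (news ++ ks) s && (map s news == map t news)) f s) nv); last first.
  move=> t tk; rewrite (reindex_inj (mulIg t^-1)%g) /=.
  apply: eq_big => [s|s _]; last by rewrite /= mulgKV.
  by rewrite /= (permutes_coset s tk nk).
rewrite sp; have : (size ks)`!%:R != 0 :> R by rewrite pnatr_eq0 -lt0n fact_gt0.
have : (size (news ++ ks))`!%:R != 0 :> R by rewrite pnatr_eq0 -lt0n fact_gt0.
move: (_`!%:R) (_`!%:R) => x y x0 y0; field.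
by rewrite y0 x0.
Qed.

Lemma sum_pick ks x (h : V -> R) : uniq ks -> x \in ks ->
  \sum_(i <- ks) (if x == i then h i else 0) = h x.
Proof.
move=> uk xk; rewrite (bigD1_seq x) //= eqxx big1 ?addr0 // => i /negbTE ix.
by rewrite eq_sym ix.
Qed.

Lemma uniform_on_insert1 a ks w v : uniq (a :: ks) -> uniform_on ks w ->
  network (a :: ks) v -> spread1 (a :: ks) a v -> uniform_on (a :: ks) (w ++ v).
Proof.
move=> un uw nv sp; apply: (@uniform_on_insert [:: a]) => // f.
pose h i : R := \sum_(s | permutes (a :: ks) s) (if s a == i then f s else 0).
rewrite (@eq_mean _ _ _ _ (fun t => h (t a))); last first.
  move=> t; rewrite big_mkcondr; apply: eq_bigr => s _.
  by rewrite /= eqseq_cons andbT.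
rewrite sp /h exchange_big /=.
rewrite (eq_bigr f); last first.
  by move=> s sk; rewrite (@sum_pick _ _ (fun=> f s)) // permutes_mem // inE eqxx.
rewrite factS natrM; have : (size ks)`!%:R != 0 :> R by rewrite pnatr_eq0 -lt0n fact_gt0.
have : (size ks).+1%:R != 0 :> R by rewrite pnatr_eq0.
by move: (_`!%:R) (_.+1%:R) => x y x0 y0; field; rewrite y0 x0.
Qed.

Lemma uniform_on_insert3 a b c ks w v : uniq [:: a, b, c & ks] ->
  uniform_on ks w -> network [:: a, b, c & ks] v ->
  spread3 [:: a, b, c & ks] a b c v -> uniform_on [:: a, b, c & ks] (w ++ v).
Proof.
move=> un uw nv sp; apply: (@uniform_on_insert [:: a; b; c]) => // f.
set K := [:: a, b, c & ks] in un nv sp *.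
(* The sum of f over a coset, as a function of the three final positions. *)
pose F i j k : R := \sum_(s | permutes K s)
  (if s a == i then if s b == j then if s c == k then f s else 0 else 0 else 0).
have [ab ac bc] := uniq3P (uniq3 un).
rewrite (@eq_mean _ _ _ _ (fun t => F (t a) (t b) (t c))); last first.
  move=> t; rewrite big_mkcondr; apply: eq_bigr => s _.
  by rewrite /= !eqseq_cons andbT; case: eqP => //= _; case: eqP => //= _.
rewrite sp; last first.
  have F0 i j k : [|| i == j, i == k | j == k] -> F i j k = 0.
    move=> eq; apply: big1 => s _; case: eqP => // ea; case: eqP => // eb.
    case: eqP => // ec; move: eq; rewrite -ea -eb -ec !(inj_eq perm_inj).
    by rewrite (negbTE ab) (negbTE ac) (negbTE bc).
  by move=> i j; split; apply: F0; rewrite eqxx ?orbT.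
have -> : total3 K F = \sum_(s | permutes K s) f s.
  rewrite /total3 /sum3 /F.
  under eq_bigr do under eq_bigr do rewrite exchange_big /=.
  under eq_bigr do rewrite exchange_big /=.
  rewrite exchange_big /=; apply: eq_bigr => s sk.
  have mem x : x \in K -> s x \in K by rewrite (permutes_mem _ sk).
  rewrite -[RHS](@sum_pick K (s a) (fun=> f s)) //; last first.
    by apply: mem; rewrite !inE eqxx.
  apply: eq_bigr => i _; case: eqP => _; last first.
    by rewrite big1 // => j _; rewrite big1.
  rewrite -[RHS](@sum_pick K (s b) (fun=> f s)) //; last first.
    by apply: mem; rewrite !inE eqxx orbT.
  apply: eq_bigr => j _; case: eqP => _; last by rewrite big1.
  rewrite (@sum_pick K (s c) (fun=> f s)) //.
  by apply: mem; rewrite !inE eqxx !orbT.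
rewrite /arrangements3 /= !factS !natrM -!natr1.
have : (size ks)`!%:R != 0 :> R by rewrite pnatr_eq0 -lt0n fact_gt0.
have : 0 <= (size ks)%:R :> R by [].
move: (_`!%:R) ((size ks)%:R); clear=> x y y0 x0.
field; rewrite x0 /=; apply/and3P; split; lra.
Qed.

(** * Cost of shuffling *)

Definition shuffle_cost n l := forall ks, uniq ks -> size ks = n ->
  exists w, [/\ network ks w, size w = l & uniform_on ks w].

Lemma shuffle_cost0 : shuffle_cost 0 0.
Proof.
move=> [|//] _ _; exists [::]; split=> // f /=.
rewrite (big_pred1 1%g) ?fact0 ?divr1 // => s; apply/idP/eqP => [sk|->].
  by apply/permP => x; rewrite perm1 (permutes_fix sk).
exact: perm_on1.
Qed.

Lemma shuffle_costS n l : shuffle_cost n l -> shuffle_cost n.+1 (l + n).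
Proof.
move=> C [//|a ks] un [sk]; have /andP[aks uk] := un.
have [w [nw sw uw]] := C _ uk sk.
have nS := network_star R aks.
exists (w ++ star R a ks); split.
- rewrite network_cat nS andbT; apply: sub_network nw => z zk.
  by rewrite inE zk orbT.
- by rewrite size_cat size_star sw sk.
- exact: uniform_on_insert1 uw nS (star_spread un).
Qed.

Lemma shuffle_cost_triple n l l' : shuffle_cost n l ->
  triple_cost R V n.+3 l' -> shuffle_cost n.+3 (l + l').
Proof.
move=> C T [|a [|b [|c ks]]] // un sk.
have [v [nv sv sp]] := T _ _ _ _ un sk.
have uk : uniq ks by move: un => /= /and4P[].
have [w [nw sw uw]] : exists w, [/\ network ks w, size w = l & uniform_on ks w].
  by apply: C => //; case: sk.
exists (w ++ v); split.
- rewrite network_cat nv andbT; apply: sub_network nw => z zk.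
  by rewrite !inE zk !orbT.
- by rewrite size_cat sw sv.
- exact: uniform_on_insert3 uw nv sp.
Qed.

(** The deck grows from n to n + 3 cards at a cost of about 2n, and
    2(n + (n - 3) + ...) is about n^2 / 3. *)
Lemma shuffle_cost_log n :
  exists2 l, (3 * l <= n * n.-1 + 7 * n * (trunc_log 2 n).+1)%N & shuffle_cost n l.
Proof.
have [m] := ubnP n; elim: m n => // m IH n nm.
have [n3|n3] := ltnP n 3.
  have c0 := shuffle_cost0.
  have c1 : shuffle_cost 1 0 := shuffle_costS c0.
  have c2 : shuffle_cost 2 1 := shuffle_costS c1.
  case: n n3 {nm} => [|[|[|//]]] _; [by exists 0%N|by exists 0%N|by exists 1%N].
case: n n3 nm => [|[|[|n]]] // n3 nm.
have [l ll c] := IH n (ltnW (ltnW nm)).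
have [l' ll' c'] := triple_cost_log R V n3.
exists (l + l')%N; last exact: shuffle_cost_triple c c'.
have LL : (trunc_log 2 n <= trunc_log 2 n.+3)%N by apply: leq_trunc_log; lia.
move: LL ll ll'; move: (trunc_log 2 n) (trunc_log 2 n.+3) => L L' LL ll ll'.
have : (n * L <= n * L')%N by rewrite leq_mul2l LL orbT.
case: n {nm n3 c c'} ll ll' => [|n] /=; nia.
Qed.

(** Six cards need 3 + 11 = 14 swaps, one less than 'C(6, 2); inserting further
    cards one by one keeps this advantage of one swap. *)
Lemma shuffle_cost_lt_bin2 n : (6 <= n)%N ->
  exists2 l, (l < 'C(n, 2))%N & shuffle_cost n l.
Proof.
elim: n => // n IH; rewrite leq_eqVlt => /orP[/eqP <-|n6].
  have c0 := shuffle_cost0.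
  have c3 : shuffle_cost 3 3 := shuffle_costS (shuffle_costS (shuffle_costS c0)).
  have d6 : triple_cost R V 6 11 := triple_cost_double (leqnn 3) (@sym_triple_cost3 R V).
  by exists 14%N => //; exact: shuffle_cost_triple c3 d6.
have [l ll c] := IH n6; exists (l + n)%N; last exact: shuffle_costS.
by rewrite binS bin1; lia.
Qed.

End Shuffles.

(** * From networks to sequences of lazy transpositions *)

Section Link.
Variables (R : realType) (n : nat).

(** Sequences of lazy transpositions grow at their end, so the induction removes
    the last entry of the network. *)
Lemma network_comp_law (ks : seq 'I_n) l (w : seq ('I_n * 'I_n * R)) :
  size w = l -> network ks w ->
  exists T : 'I_l -> lazy_transposition R n,
    forall s, comp_law T s = mean w (fun t => (t == s)%:R).
Proof.
elim/last_ind: w l => [|w [[a b] p] IH] l.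
  case: l => // _ _.
  have [T] : exists T : 'I_0 -> lazy_transposition R n, True.
    by unshelve eexists; [case|].
  by exists T => s; rewrite comp_law0 /= eq_sym.
rewrite size_rcons -cats1 network_cat; case: l => // l [sw] /andP[nw].
rewrite /= andbT => /and4P[ab p01 _ _].
have [T TE] := IH l sw nw.
exists (ext_last T (LazyTransposition ab p01)) => s.
rewrite comp_law_ext !TE mean_cat /=.
rewrite -!meanZ -meanD; apply: eq_mean => t.
by rewrite !mulg1 -(inj_eq (mulIg (tperm a b))) -mulgA tperm2 mulg1.
Qed.

Lemma shuffle_cost_achievable l :
  shuffle_cost R 'I_n n l -> achievable R n l.
Proof.
move=> C; have [w [nw sw uw]] := C _ (enum_uniq 'I_n) (size_enum_ord n).
have [T TE] := network_comp_law sw nw.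
exists T => s; rewrite TE uw size_enum_ord cardsT card_Sn.
rewrite (bigD1 s) /=; last first.
  by apply/fintype.subsetP => x _; rewrite inE mem_enum.
rewrite eqxx big1 ?addr0 ?mul1r // => t /andP[_ /negbTE ->] //.
Qed.

Lemma U_le l : shuffle_cost R 'I_n n l -> (U R n <= l)%N.
Proof. by move=> /shuffle_cost_achievable; have [_] := UP R n; apply. Qed.

End Link.

(** * Bounds on U *)

Section Bounds.
Variable R : realType.

Lemma bin2_mul2 n : ('C(n, 2) * 2 = n * n.-1)%N.
Proof. by have := bin_ffact n 2; rewrite ffactnS ffactn1. Qed.

Lemma U_log n : (3 * U R n <= n * n.-1 + 7 * n * (trunc_log 2 n).+1)%N.
Proof.
have [l ll /U_le Ul] := shuffle_cost_log R 'I_n n.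
by apply: leq_trans ll; rewrite leq_mul2l.
Qed.

Lemma U_lt_bin2 n : (6 <= n)%N -> (U R n < 'C(n, 2))%N.
Proof.
move=> n6; have [l ll /U_le Ul] := shuffle_cost_lt_bin2 R 'I_n n6.
exact: leq_ltn_trans ll.
Qed.

(** Beyond 256 = 2 ^ 8 the logarithmic term of U_log is at most n(n - 1)/4. *)
Lemma ltn_lin_exp2 L : (8 <= L)%N -> (28 * L.+1 < 2 ^ L)%N.
Proof.
elim: L => // L IH; rewrite leq_eqVlt => /orP[/eqP <- //|L8].
by have := IH L8; rewrite expnS; lia.
Qed.

Lemma U_large n : (256 <= n)%N -> (6 * U R n <= 5 * 'C(n, 2))%N.
Proof.
move=> n256; have := U_log n; have := bin2_mul2 n.
have L8 : (8 <= trunc_log 2 n)%N by apply: trunc_log_max.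
have n0 : (0 < n)%N by apply: leq_trans n256.
have /andP[Ln _] := trunc_log_bounds (isT : (1 < 2)%N) n0.
have := leq_trans (ltn_lin_exp2 L8) Ln.
move: (trunc_log 2 n) => L nL e b.
have : (n * (28 * L.+1) <= n * n.-1)%N by rewrite leq_mul2l; lia.
by lia.
Qed.

End Bounds.

Local Open Scope classical_set_scope.
Local Open Scope ring_scope.

Theorem theorem2 (R : realType) :
  (exists eps : R, 0 < eps /\
     forall n : nat, (6 <= n)%N ->
       (U R n)%:R <= (1 - eps) * 'C(n, 2)%:R) /\
  (exists h : nat -> R,
     h =O_\oo (fun n : nat => n%:R * ln n%:R) /\
     forall n : nat, (U R n)%:R <= 2 / 3 * 'C(n, 2)%:R + h n).
Proof.
split.
  (* Below 256 the saving of one swap is at least this proportion of 'C(n, 2);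
     from 256 on the saving is a sixth. *)
  exists ((256 * 256)^-1); split; first by rewrite invr_gt0 mulr_gt0.
  move=> n n6; have [n256|n256] := ltnP n 256.
    have := U_lt_bin2 R n6; rewrite -(ler_nat R) -natr1.
    have := bin2_mul2 n => /(congr1 (fun m : nat => m%:R : R)); rewrite !natrM.
    have : (n.-1)%:R <= 256 :> R by rewrite ler_nat; lia.
    have : n%:R <= 256 :> R by rewrite ler_nat ltnW.
    have : 0 <= n%:R :> R by [].
    have : 0 <= n.-1%:R :> R by [].
    move: (U R n)%:R ('C(n, 2)%:R : R) n%:R n.-1%:R => u c x y y0 x0 x1 y1 e h.
    have : x * y <= 256 * 256 by apply: ler_pM.
    lra.
  have := U_large R n256; rewrite -(ler_nat R) !natrM.
  have : 0 <= 'C(n, 2)%:R :> R by [].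
  move: (U R n)%:R ('C(n, 2)%:R : R) => u c; lra.
exists (fun n => 7 / 3 * n%:R * (trunc_log 2 n).+1%:R); split; last first.
  move=> n; have := U_log R n; have := bin2_mul2 n.
  move=> /(congr1 (fun m : nat => m%:R : R)); rewrite -(ler_nat R) natrD !natrM.
  lra.
have ln2 : 0 < ln 2 :> R by rewrite ln_gt0 // ltr1n.
apply/eqO_exP; exists (14 / 3 / ln 2); first by rewrite divr_gt0.
exists 2%N => // n /= n2.
have /andP[Ln _] := trunc_log_bounds (isT : (1 < 2)%N) (ltnW n2 : (0 < n)%N).
have L1 : (1 <= trunc_log 2 n)%N by apply: trunc_log_max.
have n1 : 1 <= n%:R :> R by rewrite ler1n; lia.
have lnn : (trunc_log 2 n)%:R * ln 2 <= ln n%:R :> R.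
  rewrite mulrC mulr_natr -lnXn ?ltr0n // -natrX ler_ln ?posrE ?ltr0n ?expn_gt0 ?ler_nat //.
  lia.
rewrite !ger0_norm; first last.
- by rewrite !mulr_ge0.
- by rewrite mulr_ge0 // ln_ge0.
have -> : 14 / 3 / ln 2 * (n%:R * ln n%:R) = n%:R * (14 / 3 * (ln n%:R / ln 2)) :> R.
  by ring.
have -> : 7 / 3 * n%:R * (trunc_log 2 n).+1%:R =
          n%:R * (7 / 3 * (trunc_log 2 n).+1%:R) :> R by ring.
apply: ler_wpM2l => //.
have : (trunc_log 2 n)%:R <= ln n%:R / ln 2 :> R by rewrite ler_pdivlMr.
have : (1 : R) <= (trunc_log 2 n)%:R by rewrite ler1n.
rewrite -natr1; lra.
Qed.
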